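(* Let $L$ be an Archimedean vector lattice, $\mathcal{T}$ a maximal multi-truncation on $L$, and $\mathcal{Q}$ a dense subset of $\mathcal{P}$. Then the map $\Lambda:L\to C^{\infty}(\mathcal{Q}_{\mathcal{T}})$ defined by $\Lambda(f)=\widehat{f}$ for all $f\in L$ is a one-to-one lattice homomorphism such that $$\Lambda(f^{\ast})=1_{\mathcal{Q}^{\ast}}\wedge\Lambda(f)\quad\text{for all }\ast\in\mathcal{T}\text{ and }f\in L^{+}.$$
   Context: All vector lattices are real; $L^{+}$ is the positive cone of $L$. $L$ is Archimedean if $f,g\in L^{+}$ and $nf\leq g$ for all $n\in\{1,2,\dots\}$ imply $f=0$. A truncation on $L$ is a nonzero function (not identically zero) $L^{+}\to L^{+}$, $f\mapsto f^{\ast}$, such that (a) $f\wedge g^{\ast}\leq f^{\ast}\leq f$ for all $f,g\in L^{+}$; and (b) if $f\in L^{+}$ and $(nf)^{\ast}=nf$ for all $n\in\{1,2,\dots\}$, then $f=0$. A multi-truncation on $L$ is a family $\mathcal{T}$ of truncations on $L$ such that $f^{\ast}\wedge f^{\rtimes}=0$ for all $f\in L^{+}$ and all $\ast,\rtimes\in\mathcal{T}$ with $\ast\neq\rtimes$. It is maximal if it is not strictly contained in another multi-truncation on $L$. An ideal of $L$ is a vector subspace $P$ such that $f\in P$, $g\in L$, $|g|\leq|f|$ imply $g\in P$; it is prime if $f\wedge g\in P$ implies $f\in P$ or $g\in P$. $\mathcal{P}$ is the set of all proper prime ideals of $L$. For non-empty $\mathcal{Q}\subset\mathcal{P}$ and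 $f\in L$, $[\mathcal{Q}]_{f}=\{P\in\mathcal{Q}:f\notin P\}$; the sets $[\mathcal{Q}]_{f}$, $f\in L^{+}$, form a base of the hull-kernel topology on $\mathcal{Q}$, and every non-empty subset of $\mathcal{P}$ carries this topology. Put $\mathcal{Q}^{\ast}=\bigcup_{f\in L^{+}}[\mathcal{Q}]_{f^{\ast}}$ for $\ast\in\mathcal{T}$ and $\mathcal{Q}_{\mathcal{T}}=\bigcup_{\ast\in\mathcal{T}}\mathcal{Q}^{\ast}$ (the sets $\mathcal{Q}^{\ast}$ are pairwise disjoint). For $f\in L$, the function $\widehat{f}:\mathcal{Q}_{\mathcal{T}}\to\overline{\mathbb{R}}=[-\infty,\infty]$ is defined as follows: for $P\in\mathcal{Q}_{\mathcal{T}}$ let $\ast$ be the unique element of $\mathcal{T}$ with $P\in\mathcal{Q}^{\ast}$, choose an arbitrary $u$ in $\pi^{\ast}(P)=\{v\in L^{+}:(v-v^{\ast})^{\ast}\notin P\}$, and put $\widehat{f}(P)=\inf\{\alpha\in\mathbb{R}:(f-\alpha u^{\ast})^{+}\in P\}$, with $\inf\mathbb{R}=-\infty$ and $\inf\emptyset=\infty$ (the value does not depend on the choice of $u\in\pi^{\ast}(P)$). For a topological space $X$, $C^{\infty}(X)$ is the set of all continuous $\varphi:X\to\overline{\mathbb{R}}$ such that $\{x:|\varphi(x)|\neq\infty\}$ is dense in $X$, with the pointwise ordering. For $\varphi,\psi,\chi\in C^{\infty}(X)$, $\chi=\varphi+\psi$ means $\chi(x)=\varphi(x)+\psi(x)$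 wherever $\varphi(x),\psi(x)$ are both finite. A lattice homomorphism into $C^{\infty}(X)$ is a map that is linear (in this sense of addition) and preserves finite suprema and infima. $1_{D}$ is the characteristic function of $D$.
   Formalization: The set π*(P) can be empty for some P in Q* (e.g. L = C_0(]0,1]), f* = min(f,1), P given by an ultrafilter converging to 0), leaving f̂(P) undefined; the formal statement puts f̂(P) = 0 at such P and uses the stated formula everywhere else. *)

(* Defs.v *)
From HB Require Import structures.
From mathcomp Require Export all_boot all_order all_algebra.
From mathcomp Require Export all_classical all_reals all_analysis.

Set Implicit Arguments.
Unset Strict Implicit.
Unset Printing Implicit Defensive.

Export Order.TTheory GRing.Theory Num.Theory.
Export numFieldNormedType.Exports.

Local Open Scope classical_set_scope.
Local Open Scope ring_scope.

HB.mixin Record isVectorLattice (R : realType) (L : Type)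
    of GRing.Lmodule R L & Num.POrderedZmodule L := {
  vlat_leD2r : forall x y z : L, x <= y -> x + z <= y + z;
  vlat_scale_ge0 : forall (a : R) (x : L), 0 <= a -> 0 <= x -> 0 <= a *: x;
  vlat_meet : L -> L -> L;
  vlat_join : L -> L -> L;
  vlat_meetP : forall x y z, (x <= vlat_meet y z) = (x <= y) && (x <= z);
  vlat_joinP : forall x y z, (vlat_join x y <= z) = (x <= z) && (y <= z)
}.

#[short(type="vectorLatticeType")]
HB.structure Definition VectorLattice (R : realType) :=
  { L of GRing.Lmodule R L & Num.POrderedZmodule L & isVectorLattice R L }.

(* Makes the order-theoretic notations and lemmas for lattices available on
   every vector lattice; the order is the one of the ordered group L. *)
HB.instance Definition _ (R : realType) (L : vectorLatticeType R) :=
  Order.POrder_MeetJoin_isLattice.Build ring_display (VectorLattice.sort L)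
    (@vlat_meetP R L) (@vlat_joinP R L).

Section VectorLattices.
Context {R : realType} {L : vectorLatticeType R}.

Definition vabs (x : L) : L := (x `|` - x)%O.
Definition vpos (x : L) : L := (x `|` 0)%O.

Lemma vlat_subr_ge0 (x y : L) : x <= y -> 0 <= y - x.
Proof. by move=> xy; rewrite -(subrr x); exact: vlat_leD2r. Qed.

Lemma vlat_addr_ge0 (x y : L) : 0 <= x -> 0 <= y -> 0 <= x + y.
Proof.
by move=> x0 y0; apply: (le_trans y0); rewrite -[leLHS]add0r; exact: vlat_leD2r.
Qed.

Lemma vlat_mulrn_ge0 (x : L) n : 0 <= x -> 0 <= x *+ n.
Proof.
by move=> x0; elim: n => [|n IHn]; rewrite ?mulr0n// mulrS; exact: vlat_addr_ge0.
Qed.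

Lemma vabs_ge0 (x : L) : 0 <= vabs x.
Proof.
have h : 0 <= vabs x + vabs x.
  apply: (@le_trans _ _ (x + vabs x)); last exact/vlat_leD2r/leUl.
  rewrite addrC -[X in _ + X]opprK; apply: vlat_subr_ge0; exact: leUr.
have -> : vabs x = (2%:R^-1 : R) *: (vabs x + vabs x).
  by rewrite -mulr2n -[X in _ *: X](scaler_nat 2 (vabs x)) scalerA mulVf ?scale1r// pnatr_eq0.
by apply: vlat_scale_ge0 => //; rewrite invr_ge0 ler0n.
Qed.

Lemma le_vabs (x : L) : x <= vabs x. Proof. exact: leUl. Qed.

Lemma ge0_vabs (x : L) : 0 <= x -> vabs x = x.
Proof.
move=> x0; apply/eqP; rewrite eq_le le_vabs andbT leUx lexx/=.
by apply: (le_trans _ x0); have := vlat_leD2r _ _ (- x) x0; rewrite add0r subrr.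
Qed.

End VectorLattices.

Definition archimedean {R : realType} (L : vectorLatticeType R) : Prop :=
  forall f g : L, 0 <= f -> 0 <= g ->
    (forall n : nat, (0 < n)%N -> f *+ n <= g) -> f = 0.

Record poscone {R : realType} (L : vectorLatticeType R) :=
  PosCone { pval :> L; pval_ge0 : 0 <= pval }.

HB.instance Definition _ (R : realType) (L : vectorLatticeType R) :=
  [isSub for @pval R L].
HB.instance Definition _ (R : realType) (L : vectorLatticeType R) :=
  [Choice of poscone L by <:].
HB.instance Definition _ (R : realType) (L : vectorLatticeType R) :=
  isPointed.Build (poscone L) (PosCone (lexx 0)).

Section Truncations.
Context {R : realType} {L : vectorLatticeType R}.

Definition pmuln (f : poscone L) (n : nat) : poscone L :=
  PosCone (vlat_mulrn_ge0 n (pval_ge0 f)).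

Record truncation := Truncation {
  trunc :> poscone L -> poscone L;
  trunc_nonzero : exists f : poscone L, pval (trunc f) <> 0;
  trunc_meet_le : forall f g : poscone L,
    (pval f `&` pval (trunc g))%O <= pval (trunc f);
  trunc_le : forall f : poscone L, pval (trunc f) <= pval f;
  trunc_arch : forall f : poscone L,
    (forall n : nat, (0 < n)%N -> trunc (pmuln f n) = pmuln f n) -> pval f = 0
}.

Definition multi_truncation (T : set truncation) : Prop :=
  forall s t : truncation, T s -> T t -> s <> t ->
    forall f : poscone L, (pval (s f) `&` pval (t f))%O = 0.

Definition maximal_multi_truncation (T : set truncation) : Prop :=
  multi_truncation T /\
  forall S : set truncation, multi_truncation S -> ~ (T `<` S).

Definition remainder (t : truncation) (v : poscone L) : poscone L :=
  PosCone (vlat_subr_ge0 (trunc_le t v)).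

End Truncations.
Arguments truncation {R} L.

Section PrimeIdeals.
Context {R : realType} {L : vectorLatticeType R}.

Definition lattice_ideal (P : L -> Prop) : Prop :=
  [/\ P 0,
      forall f g, P f -> P g -> P (f + g),
      forall (a : R) f, P f -> P (a *: f)
    & forall f g, P f -> vabs g <= vabs f -> P g].

Record prime_ideal := PrimeIdeal {
  pideal :> L -> Prop;
  pideal_ideal : lattice_ideal pideal;
  pideal_prime : forall f g, pideal (f `&` g)%O -> pideal f \/ pideal g;
  pideal_proper : exists f, ~ pideal f
}.

HB.instance Definition _ := gen_eqMixin prime_ideal.
HB.instance Definition _ := gen_choiceMixin prime_ideal.

Definition cohull (Q : set prime_ideal) (f : L) : set prime_ideal :=
  [set P : prime_ideal | Q P /\ ~ P f].

Lemma cohull_cover : \bigcup_(f : poscone L) cohull setT f = setT.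
Proof.
apply/seteqP; split=> // P _; have [f Pf] := pideal_proper P.
exists (PosCone (vabs_ge0 f)) => //; split=> //= Paf; apply: Pf.
by have [_ _ _ h] := pideal_ideal P; apply: h Paf _; exact: le_vabs.
Qed.

Lemma cohull_join (f g : poscone L) (P : prime_ideal) :
  setT f -> setT g -> cohull setT f P -> cohull setT g P ->
  exists h : poscone L, [/\ setT h, cohull setT h P
    & cohull setT h `<=` cohull setT f `&` cohull setT g].
Proof.
move=> _ _ [_ Pf] [_ Pg].
have fg0 : 0 <= (pval f `&` pval g)%O by rewrite lexI !pval_ge0.
exists (PosCone fg0); split=> //; first by split=> //= /pideal_prime[].
move=> I [_ /= Ifg]; have [_ _ _ h] := pideal_ideal I.
split; split=> // If; apply: Ifg; apply: h If _;
  by rewrite !ge0_vabs ?pval_ge0// ?leIl ?leIr.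
Qed.

(* The hull-kernel topology. A subset Q of the space of all proper prime ideals,
   seen as a type, gets the topology induced by inclusion; its basic open sets
   are the traces on Q of the sets cohull setT f, that is the sets cohull Q f. *)
HB.instance Definition _ :=
  isBaseTopological.Build prime_ideal cohull_cover cohull_join.

End PrimeIdeals.
Arguments prime_ideal {R} L.

Section Representation.
Context {R : realType} {L : vectorLatticeType R}.

Definition Qstar (Q : set (prime_ideal L)) (t : truncation L) :
  set (prime_ideal L) := \bigcup_(f : poscone L) cohull Q (t f).

Definition Qdom (Q : set (prime_ideal L)) (T : set (truncation L)) :
  set (prime_ideal L) := \bigcup_(t in T) Qstar Q t.

Definition unit_at (t : truncation L) (P : prime_ideal L) : set (poscone L) :=
  [set v | ~ P (t (remainder t v))].

Definition trunc_at (Q : set (prime_ideal L)) (T : set (truncation L))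
  (P : Qdom Q T) : truncation L := s2val (cid2 (set_valP P)).

(* An arbitrary element of [unit_at t P] when this set is nonempty. *)
Definition choose_unit (t : truncation L) (P : prime_ideal L) : poscone L :=
  xget point (unit_at t P).

(* [unit_at t P] can be empty: take L = C_0(]0, 1]) truncated by min(f, 1) and
   P the functions vanishing on a member of an ultrafilter converging to 0; then
   P is in [Qstar Q t], yet v and min(v, 1) agree near 0 for every v. The formula
   with a unit says nothing there, and the value is set to 0. When Q is dense,
   the points with a unit are dense in [Qdom Q T], and 0 is the only value for
   which [hat f] can be continuous on [Qdom Q T]. *)
Definition hat (Q : set (prime_ideal L)) (T : set (truncation L))
    (f : L) (P : Qdom Q T) : \bar R :=
  let t := trunc_at P in
  let u := choose_unit t (val P) in
  if `[< unit_at t (val P) !=set0 >] then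
    ereal_inf [set a%:E | a in [set a : R | val P (vpos (f - a *: pval (t u)))]]
  else 0%E.

End Representation.

Record Cinf (R : realType) (X : topologicalType) := MkCinf {
  cinf_fun :> X -> \bar R;
  cinf_continuous : continuous cinf_fun;
  cinf_dense : dense [set x | `|cinf_fun x|%E != +oo%E]
}.

Section CinfLattice.
Context {R : realType} {X : topologicalType}.

HB.instance Definition _ := gen_eqMixin (Cinf R X).
HB.instance Definition _ := gen_choiceMixin (Cinf R X).

Implicit Types phi psi chi : Cinf R X.

Lemma cinf_eq phi psi : phi =1 psi -> phi = psi.
Proof.
case: phi psi => [f f1 f2] [g g1 g2] /= /funext fg; subst g.
by congr MkCinf; exact: Prop_irrelevance.
Qed.

Definition cinf_le phi psi : bool := `[< forall x, (phi x <= psi x)%E >].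

Lemma cinf_le_refl : reflexive cinf_le.
Proof. by move=> phi; apply/asboolP. Qed.

Lemma cinf_le_anti : antisymmetric cinf_le.
Proof.
move=> phi psi /andP[/asboolP h1 /asboolP h2]; apply: cinf_eq => x.
by apply/eqP; rewrite eq_le h1 h2.
Qed.

Lemma cinf_le_trans : transitive cinf_le.
Proof.
move=> psi phi chi /asboolP h1 /asboolP h2.
by apply/asboolP => x; exact: le_trans (h2 x).
Qed.

Fact cinf_display : Order.disp_t. Proof. exact: Order.default_display. Qed.

HB.instance Definition _ := Order.Le_isPOrder.Build cinf_display (Cinf R X)
  cinf_le_refl cinf_le_anti cinf_le_trans.

Lemma cinf_open phi : open [set x | `|phi x|%E != +oo%E].
Proof.
have -> : [set x | `|phi x|%E != +oo%E] = phi @^-1` `]-oo%E, +oo%E[.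
  by apply/seteqP; split=> x /=; rewrite in_itv/= ltNye ltey; case: (phi x).
apply: open_comp; last exact: itv_open.
by move=> x _; exact: cinf_continuous.
Qed.

Lemma cinf_dense2 phi psi :
  dense ([set x | `|phi x|%E != +oo%E] `&` [set x | `|psi x|%E != +oo%E]).
Proof.
by apply: denseI; [exact: cinf_open | exact: cinf_dense | exact: cinf_dense].
Qed.

Lemma cinf_min_dense phi psi :
  dense [set x | `|Order.min (phi x) (psi x)|%E != +oo%E].
Proof.
move=> O O0 oO; have [x [Ox [h1 h2]]] := cinf_dense2 phi psi O0 oO.
by exists x; split=> //=; rewrite /Order.min; case: ifP.
Qed.

Lemma cinf_max_dense phi psi :
  dense [set x | `|Order.max (phi x) (psi x)|%E != +oo%E].
Proof.
move=> O O0 oO; have [x [Ox [h1 h2]]] := cinf_dense2 phi psi O0 oO.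
by exists x; split=> //=; rewrite /Order.max; case: ifP.
Qed.

Definition cinf_meet phi psi : Cinf R X :=
  MkCinf (min_fun_continuous (@cinf_continuous _ _ phi)
                             (@cinf_continuous _ _ psi))
         (cinf_min_dense phi psi).

Definition cinf_join phi psi : Cinf R X :=
  MkCinf (max_fun_continuous (@cinf_continuous _ _ phi)
                             (@cinf_continuous _ _ psi))
         (cinf_max_dense phi psi).

Lemma cinf_meetP chi phi psi :
  (chi <= cinf_meet phi psi)%O = (chi <= phi)%O && (chi <= psi)%O.
Proof.
apply/idP/andP => [/asboolP h|[/asboolP h1 /asboolP h2]].
  by split; apply/asboolP => x; have := h x; rewrite /= le_min => /andP[].
by apply/asboolP => x /=; rewrite le_min h1 h2.
Qed.

Lemma cinf_joinP phi psi chi :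
  (cinf_join phi psi <= chi)%O = (phi <= chi)%O && (psi <= chi)%O.
Proof.
apply/idP/andP => [/asboolP h|[/asboolP h1 /asboolP h2]].
  by split; apply/asboolP => x; have := h x; rewrite /= ge_max => /andP[].
by apply/asboolP => x /=; rewrite ge_max h1 h2.
Qed.

HB.instance Definition _ := Order.POrder_MeetJoin_isLattice.Build
  cinf_display (Cinf R X) cinf_meetP cinf_joinP.

Definition cinf_is_sum phi psi chi : Prop :=
  forall x, phi x \is a fin_num -> psi x \is a fin_num ->
    chi x = (phi x + psi x)%E.

(* On [\bar R], 0 * +oo = 0 * -oo = 0. *)
Definition cinf_is_scale (a : R) phi chi : Prop :=
  forall x, chi x = (a%:E * phi x)%E.

End CinfLattice.

Definition cinf_lattice_hom {R : realType} {L : vectorLatticeType R}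
    {X : topologicalType} (Lam : L -> Cinf R X) : Prop :=
  [/\ forall f g, cinf_is_sum (Lam f) (Lam g) (Lam (f + g)),
      forall (a : R) f, cinf_is_scale a (Lam f) (Lam (a *: f)),
      {morph Lam : f g / (f `|` g)%O}
    & {morph Lam : f g / (f `&` g)%O}].

(* Main.v *)
Require Import Defs.

(** The argument takes place in the quotients of [L] by prime ideals. If [P] is
    prime, then [L / P] is totally ordered; its order pulled back to [L] is
    [lemod P]. Given a positive [e] outside [P], the extended real [qval P e f]
    locates [f] on the scale of the multiples of [e]. In a totally ordered space,
    joins and meets are maxima and minima, so [qval P e] preserves them, and it
    is additive wherever it is finite.

    A truncation [t] behaves, modulo every prime at which it does not vanish, like
    taking the minimum with one fixed element, possibly infinite. A unit [u] at
    [P] is an element strictly above its own truncation modulo [P]; it shows that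
    this fixed element is finite, namely [t u]: all values of [t] are below [t u]
    modulo [P] ([lemod_trunc_unit]), and [t f] is the minimum of [f] and [t u]
    ([lemod_trunc_meet]). So [hat f P] is [qval P (t u) f], the choice of [u] is
    immaterial, [t u] has value 1, and the formula for [t f] follows. At a prime
    without a unit the fixed element is infinite and [hat f] is 0.

    Missing a given element is an open condition on primes,
    which gives continuity ([hat_near_lt]). At a prime without a unit one uses
    that the truncated excess [t (v - t v)] of every [v] lies in the prime: if
    this excess is smaller than some [t w], then [v] is at most twice the unit
    ([lemod_small_excess]); taking for [v] large multiples of [f] makes [hat f]
    small nearby.

    Open sets contain enough points because every nonzero positive element is
    missed by some prime ([exists_prime]), hence by one in the dense set [Q]. If
    [h] is a fixed point of [t], the Archimedean property makes some multiple of
    [h] exceed [|f|] modulo many primes, where [hat f] is therefore finite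
    ([hat_finite_dense]). For injectivity, a nonzero positive [d] must meet a
    value of some [t] in [T], since otherwise meeting with [d] would be one more
    truncation to add to [T] ([maximal_meets]); as no nonzero element has all its
    multiples fixed by [t], this gives an open set of primes with a unit on which
    [d] has positive value ([hat_positive]). *)

Set Implicit Arguments.
Unset Strict Implicit.
Unset Printing Implicit Defensive.

Local Open Scope classical_set_scope.
Local Open Scope ring_scope.

(** * Vector lattices *)

Section VectorLatticeTheory.
Context {R : realType} {L : vectorLatticeType R}.
Implicit Types x y z : L.

Lemma vleD2r z x y : (x + z <= y + z) = (x <= y).
Proof.
apply/idP/idP => [h|]; last exact: vlat_leD2r.
by have := vlat_leD2r _ _ (- z) h; rewrite !addrK.
Qed.

Lemma vleD x y z t : x <= y -> z <= t -> x + z <= y + t.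
Proof.
move=> xy zt; apply: (@le_trans _ _ (y + z)); first by rewrite vleD2r.
by rewrite ![y + _]addrC vleD2r.
Qed.

Lemma vle_subl_addr x y z : (x - y <= z) = (x <= z + y).
Proof. by rewrite -[RHS](vleD2r (- y)) addrK. Qed.

Lemma vle_subr_addr x y z : (x <= y - z) = (x + z <= y).
Proof. by rewrite -[RHS](vleD2r (- z)) addrK. Qed.

Lemma vsubr_ge0 x y : (0 <= x - y) = (y <= x).
Proof. by rewrite vle_subr_addr add0r. Qed.

Lemma vleN2 x y : (- x <= - y) = (y <= x).
Proof. by rewrite -[LHS]vsubr_ge0 opprK addrC vsubr_ge0. Qed.

Lemma voppr_le0 x : (- x <= 0) = (0 <= x).
Proof. by rewrite -{1}oppr0 vleN2. Qed.

Lemma vleZ (a : R) x y : 0 <= a -> x <= y -> a *: x <= a *: y.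
Proof.
by move=> a0 xy; rewrite -vsubr_ge0 -scalerBr vlat_scale_ge0 // vsubr_ge0.
Qed.

Lemma vleZr (a b : R) x : 0 <= x -> a <= b -> a *: x <= b *: x.
Proof.
by move=> x0 ab; rewrite -vsubr_ge0 -scalerBl vlat_scale_ge0 // subr_ge0.
Qed.

Lemma vmeet_ge0 x y : 0 <= x -> 0 <= y -> 0 <= (x `&` y)%O.
Proof. by move=> x0 y0; rewrite lexI x0. Qed.

Lemma vpos_ge0 x : 0 <= vpos x. Proof. exact: leUr. Qed.
Lemma le_vpos x : x <= vpos x. Proof. exact: leUl. Qed.

Lemma vpos_le x y : x <= y -> 0 <= y -> vpos x <= y.
Proof. by move=> xy y0; rewrite leUx xy. Qed.

Lemma vpos_id x : 0 <= x -> vpos x = x.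
Proof. by move=> x0; apply/eqP; rewrite eq_le le_vpos vpos_le. Qed.

Lemma vpos_eq0 x : x <= 0 -> vpos x = 0.
Proof. by move=> x0; apply/eqP; rewrite eq_le vpos_ge0 vpos_le. Qed.

Lemma vpos_neq0 x : ~ x <= 0 -> vpos x <> 0.
Proof. by move=> x0 h; apply: x0; rewrite -h le_vpos. Qed.

Lemma vposD x y : vpos (x + y) <= vpos x + vpos y.
Proof.
by apply: vpos_le; [apply: vleD; exact: le_vpos|rewrite vlat_addr_ge0 ?vpos_ge0].
Qed.

Lemma vposZ (a : R) x : 0 <= a -> vpos (a *: x) <= a *: vpos x.
Proof.
by move=> a0; apply: vpos_le; [rewrite vleZ ?le_vpos|rewrite vlat_scale_ge0 ?vpos_ge0].
Qed.

Lemma vpos_addN x : vpos x = vpos (- x) + x.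
Proof.
have half z : vpos (- z) + z <= vpos z.
  rewrite -vle_subr_addr; apply: vpos_le.
    by rewrite vle_subr_addr addNr vpos_ge0.
  by rewrite vsubr_ge0 le_vpos.
apply/eqP; rewrite eq_le half andbT -vle_subl_addr.
by have := half (- x); rewrite opprK.
Qed.

(** A lower bound [z] of [vpos x] and [vpos (- x)] can be taken off [vpos x]
    without falling below [x], because [vpos x = vpos (- x) + x]; the minimality
    of [vpos x] then forces [z <= 0]. *)
Lemma vpos_disjoint x : (vpos x `&` vpos (- x))%O = 0.
Proof.
set z := (_ `&` _)%O.
have zx : z <= vpos x by exact: leIl.
have zNx : z <= vpos (- x) by exact: leIr.
apply/eqP; rewrite eq_le lexI !vpos_ge0 !andbT.
suff : vpos x <= vpos x - z.
  by rewrite vle_subr_addr -[leRHS]addr0 ![vpos x + _]addrC vleD2r.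
apply: vpos_le; last by rewrite vsubr_ge0.
by rewrite {1}vpos_addN addrAC -[leLHS]add0r vleD2r vsubr_ge0.
Qed.

(** Scaling by [a > 0] is a lattice automorphism, so multiples of disjoint
    elements are disjoint; the case [a = 0] is direct. *)
Lemma vle0_meetZ (a : R) x (f g : L) : 0 <= a ->
  (f `&` g)%O <= 0 -> x <= a *: f -> x <= a *: g -> x <= 0.
Proof.
move=> a0 fg xf xg; have [a00|an0] := eqVneq a 0.
  by move: xf; rewrite a00 scale0r.
have ai : 0 <= a^-1 by rewrite invr_ge0.
have : a^-1 *: x <= 0.
  apply: le_trans fg; rewrite lexI -[X in _ <= X](scalerK an0 f).
  by rewrite -[X in _ && (_ <= X)](scalerK an0 g) !vleZ.
by move=> /(vleZ a0); rewrite scaler0 scalerA divff// scale1r.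
Qed.

Lemma vabs_le x y : x <= y -> - x <= y -> vabs x <= y.
Proof. by move=> h1 h2; rewrite leUx h1. Qed.

Lemma leN_vabs x : - x <= vabs x. Proof. exact: leUr. Qed.

Lemma vabsD x y : vabs (x + y) <= vabs x + vabs y.
Proof. by apply: vabs_le; rewrite ?opprD vleD ?le_vabs ?leN_vabs. Qed.

Lemma vabsZ (a : R) x : vabs (a *: x) <= `|a| *: vabs x.
Proof.
have [a0|a0] := leP 0 a.
  by rewrite ger0_norm // vabs_le // -?scalerN vleZ ?le_vabs ?leN_vabs.
have Na0 : 0 <= - a by rewrite oppr_ge0 ltW.
rewrite ltr0_norm //; apply: vabs_le; last by rewrite -scaleNr vleZ ?le_vabs.
by rewrite -[leLHS]opprK -scaleNr -scalerN vleZ ?leN_vabs.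
Qed.

End VectorLatticeTheory.

(** * Ideals and the existence of prime ideals *)

Section Ideals.
Context {R : realType} {L : vectorLatticeType R}.
Implicit Types (P M : L -> Prop) (x y z : L).

Lemma ideal_vabs P x : lattice_ideal P -> P x -> P (vabs x).
Proof. by move=> [_ _ _ iS] Px; apply: iS Px _; rewrite ge0_vabs ?vabs_ge0. Qed.

Lemma ideal_le P x y : lattice_ideal P -> P y -> 0 <= x -> x <= y -> P x.
Proof.
move=> [_ _ _ iS] Py x0 xy; apply: iS Py _.
by rewrite !ge0_vabs // (le_trans x0).
Qed.

(** Membership of 0 is left out so that the union of the empty chain, which is
    empty, stays in the family. *)
Definition ideal_avoiding (h : L) : set (set L) := [set M |
  [/\ forall f g, M f -> M g -> M (f + g),
      forall (a : R) f, M f -> M (a *: f),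
      forall f g, M f -> vabs g <= vabs f -> M g
    & ~ M h]].

Lemma ideal_avoiding_bigcup h (F : set (set L)) :
  F `<=` ideal_avoiding h -> total_on F subset ->
  ideal_avoiding h (\bigcup_(M in F) M).
Proof.
move=> FI Ftot; split.
- move=> f g [M FM Mf] [N FN Ng].
  have [MN|NM] := Ftot _ _ FM FN.
    by exists N => //; have [iD _ _ _] := FI _ FN; apply: iD => //; exact: MN.
  by exists M => //; have [iD _ _ _] := FI _ FM; apply: iD => //; exact: NM.
- move=> a f [M FM Mf]; exists M => //.
  by have [_ iZ _ _] := FI _ FM; exact: iZ.
- move=> f g [M FM Mf] gf; exists M => //.
  by have [_ _ iS _] := FI _ FM; exact: iS gf.
- by move=> [M FM Mh]; have [_ _ _] := FI _ FM; exact.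
Qed.

(** The ideal generated by [M] and [f] consists of the elements whose modulus is
    below some [m + a *: f]. It is strictly larger than [M], so by maximality it
    contains [h]. *)
Lemma maximal_avoiding_absorbs h M f :
  0 <= h -> lattice_ideal M -> ~ M h ->
  (forall N, M `<` N -> ~ ideal_avoiding h N) ->
  0 <= f -> ~ M f ->
  exists m (a : R), [/\ M m, 0 <= m, 0 <= a & h <= m + a *: f].
Proof.
move=> h0 iM Mh Mmax f0 Mf; have [M0 iD iZ iS] := iM.
pose N : set L := [set x | exists m (a : R),
  [/\ M m, 0 <= m, 0 <= a & vabs x <= m + a *: f]].
have [[m [a [Mm m0 a0 hm]]]|Nh] := pselect (N h).
  by exists m, a; split=> //; apply: le_trans hm; exact: le_vabs.
exfalso; apply: (Mmax N).
  split.
    move=> x Mx; exists (vabs x), 0; split=> //; first exact: ideal_vabs.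
      exact: vabs_ge0.
    by rewrite scale0r addr0.
  move=> NM; apply: Mf; apply: NM; exists 0, 1; split=> //.
  by rewrite add0r scale1r ge0_vabs.
split=> //.
- move=> x y [m [a [Mm m0 a0 xm]]] [n [b [Mn n0 b0 yn]]].
  exists (m + n), (a + b); split; [exact: iD|exact: vlat_addr_ge0|exact: addr_ge0|].
  by rewrite scalerDl addrACA; apply: le_trans (vabsD _ _) _; exact: vleD.
- move=> c x [m [a [Mm m0 a0 xm]]].
  exists (`|c| *: m), (`|c| * a); split; [exact: iZ| |exact: mulr_ge0|].
    exact: vlat_scale_ge0.
  by rewrite -scalerA -scalerDr; apply: le_trans (vabsZ _ _) _; exact: vleZ.
- move=> x y [m [a [Mm m0 a0 xm]]] yx; exists m, a; split=> //.
  exact: le_trans yx xm.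
Qed.

(** An ideal maximal among those avoiding [h] is prime: if it missed both of two
    disjoint elements [f] and [g], then [h] would be below [m + c *: f] and below
    [m + c *: g] for a common [m] in it, and disjointness leaves [h <= m]. *)
Lemma exists_prime (h : L) : 0 <= h -> h <> 0 -> exists P : prime_ideal L, ~ P h.
Proof.
move=> h0 hn0.
have [M [[iD iZ iS Mh] Mmax]] := Zorn_bigcup (@ideal_avoiding_bigcup h).
have M0 : M 0.
  have [[x Mx]|Me] := pselect (exists x, M x).
    by rewrite -(scale0r x); exact: iZ.
  exfalso; apply: (Mmax [set 0]).
    split; first by move=> x Mx; case: Me; exists x.
    by move=> /(_ 0 erefl) M0; apply: Me; exists 0.
  split=> [f g -> ->|a f ->|f g ->|//]; rewrite ?addr0 ?scaler0//.
  rewrite (ge0_vabs (lexx 0)) => g0; apply/eqP.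
  by rewrite eq_le (le_trans (le_vabs g) g0) -oppr0 -[g]opprK vleN2
    (le_trans (leN_vabs g) g0).
have iM : lattice_ideal M by split.
(* the disjoint case; subtracting the meet reduces the general case to it *)
have Mprime (f g : L) : (f `&` g)%O = 0 -> M f \/ M g.
  move=> fg.
  have f0 : 0 <= f by rewrite -fg leIl.
  have g0 : 0 <= g by rewrite -fg leIr.
  have [|Mf] := pselect (M f); first by left.
  have [|Mg] := pselect (M g); first by right.
  exfalso; apply: (Mh).
  have [m [a [Mm m0 a0 hm]]] := maximal_avoiding_absorbs h0 iM Mh Mmax f0 Mf.
  have [n [b [Mn n0 b0 hn]]] := maximal_avoiding_absorbs h0 iM Mh Mmax g0 Mg.
  apply: (ideal_le iM (iD _ _ Mm Mn)) => //; rewrite -vsubr_ge0 -voppr_le0 opprB.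
  apply: (@vle0_meetZ _ _ (a + b) _ f g); first exact: addr_ge0.
  - by rewrite fg.
  - rewrite vle_subl_addr (le_trans hm) // addrC; apply: vleD.
      by apply: vleZr => //; rewrite lerDl.
    by rewrite -[leLHS]addr0; apply: vleD.
  - rewrite vle_subl_addr (le_trans hn) // addrC; apply: vleD.
      by apply: vleZr => //; rewrite lerDr.
    by rewrite -[leLHS]add0r; apply: vleD.
have Mp (f g : L) : M (f `&` g)%O -> M f \/ M g.
  move=> Mfg; set m := (f `&` g)%O in Mfg.
  have : ((f - m) `&` (g - m))%O = 0.
    apply/eqP; rewrite eq_le lexI !vsubr_ge0 leIl leIr !andbT.
    set k := (_ `&` _)%O.
    suff : k + m <= m by rewrite -[X in _ <= X]add0r vleD2r.
    by rewrite lexI -!vle_subr_addr leIl leIr.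
  by move=> /Mprime[] /iD /(_ Mfg); rewrite subrK; [left|right].
by exists (PrimeIdeal iM Mp (ex_intro _ h Mh)).
Qed.

End Ideals.

(** * The totally ordered quotient by a prime ideal *)

Lemma ereal_between {R : realType} (x y : \bar R) : (x < y)%E ->
  exists2 c : R, (x < c%:E)%E & (c%:E < y)%E.
Proof.
case: x y => [r| |] [s| |] //= rs.
- by exists ((r + s) / 2); rewrite lte_fin ?midf_lt.
- by exists (r + 1); rewrite ?ltry// lte_fin ltrDl.
- by exists (s - 1); rewrite ?ltNyr// lte_fin ltrBlDr ltrDl.
- by exists 0; rewrite ?ltNyr ?ltry.
Qed.

Lemma le_from_below {R : realType} (x y : \bar R) :
  (forall c : R, (c%:E < x)%E -> (c%:E <= y)%E) -> (x <= y)%E.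
Proof.
move=> h; rewrite leNgt; apply/negP => /ereal_between[c yc cx].
by have := h _ cx; rewrite leNgt yc.
Qed.

Section OrderModuloPrime.
Context {R : realType} {L : vectorLatticeType R} (P : prime_ideal L).
Implicit Types x y z : L.

Let iP : lattice_ideal P := pideal_ideal P.

(** The order of the quotient by [P], pulled back to [L]. *)
Definition lemod x y : Prop := P (vpos (x - y)).

Lemma le_lemod x y : x <= y -> lemod x y.
Proof.
move=> xy; rewrite /lemod vpos_eq0; first by case: iP.
by rewrite vle_subl_addr add0r.
Qed.

Lemma lemod_refl x : lemod x x. Proof. exact: le_lemod. Qed.

Lemma lemod0P x : 0 <= x -> lemod x 0 <-> P x.
Proof. by move=> x0; rewrite /lemod subr0 vpos_id. Qed.

Lemma lemodD x y z t : lemod x y -> lemod z t -> lemod (x + z) (y + t).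
Proof.
move=> xy zt; have [_ iD _ _] := iP; apply: (ideal_le iP (iD _ _ xy zt)).
  exact: vpos_ge0.
by rewrite opprD addrACA vposD.
Qed.

Lemma lemodDr z x y : lemod (x + z) (y + z) <-> lemod x y.
Proof. by rewrite /lemod opprD addrACA subrr addr0. Qed.

Lemma lemod_trans y x z : lemod x y -> lemod y z -> lemod x z.
Proof. by move=> xy /(lemodD xy); rewrite [y + z]addrC lemodDr. Qed.

Lemma lemodN x y : lemod (- x) (- y) <-> lemod y x.
Proof. by rewrite /lemod opprK addrC. Qed.

Lemma lemodZ (a : R) x y : 0 <= a -> lemod x y -> lemod (a *: x) (a *: y).
Proof.
move=> a0 xy; have [_ _ iZ _] := iP; apply: (ideal_le iP (iZ a _ xy)).
  exact: vpos_ge0.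
by rewrite -scalerBr vposZ.
Qed.

(** This is where primeness enters: [x - y] has disjoint positive and negative
    parts, so one of them lies in [P]. *)
Lemma lemod_total x y : lemod x y \/ lemod y x.
Proof.
apply: pideal_prime; rewrite -[y - x]opprB vpos_disjoint.
by case: iP.
Qed.

Lemma lemod_join x y z : lemod x z -> lemod y z -> lemod (x `|` y)%O z.
Proof.
move=> xz yz; have [_ iD _ _] := iP; apply: (ideal_le iP (iD _ _ xz yz)).
  exact: vpos_ge0.
apply: vpos_le; last by rewrite vlat_addr_ge0 ?vpos_ge0.
rewrite vle_subl_addr leUx; apply/andP; split; rewrite -vle_subl_addr.
  by rewrite -[leLHS]addr0 vleD ?le_vpos ?vpos_ge0.
by rewrite -[leLHS]add0r vleD ?le_vpos ?vpos_ge0.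
Qed.

Lemma lemod_meet x y z : lemod z x -> lemod z y -> lemod z (x `&` y)%O.
Proof.
move=> zx zy; rewrite -lemodN; apply: lemod_trans (lemod_join _ _); first last.
- by apply/lemodN; exact: zy.
- by apply/lemodN; exact: zx.
apply: le_lemod; rewrite -[leRHS]opprK vleN2 lexI.
by apply/andP; split; rewrite -[leRHS]opprK vleN2 ?leUl ?leUr.
Qed.

(** Leaving [P] is an open condition in the hull-kernel topology, so this turns
    strict inequalities modulo one prime into inequalities on a neighborhood. *)
Lemma lemod_vpos x y : ~ P (vpos (y - x)) -> lemod x y.
Proof. by move=> h; have [//|] := lemod_total x y. Qed.

Section ValueAlong.
Variable e : L.

(** Position of [f] on the scale [e] in the ordered vector space [L / P]: for
    [e] positive outside [P] this is the extended real [f / e] up to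
    infinitesimals. *)
Definition qval (f : L) : \bar R :=
  ereal_inf [set a%:E | a in [set a : R | lemod f (a *: e)]].

Hypotheses (e0 : 0 <= e) (Pe : ~ P e).

Lemma lemod_scale_le (a b : R) : lemod (a *: e) (b *: e) -> a <= b.
Proof.
rewrite /lemod -scalerBl leNgt => h; apply/negP => ba.
have ab0 : 0 < a - b by rewrite subr_gt0.
move: h; rewrite vpos_id ?vlat_scale_ge0 ?(ltW ab0)// => Pab.
have [_ _ iZ _] := iP; apply: Pe.
by rewrite -(scalerK (lt0r_neq0 ab0) e); exact: iZ.
Qed.

Lemma le_lemod_scale (a b : R) : a <= b -> lemod (a *: e) (b *: e).
Proof. by move=> ab; apply: le_lemod; exact: vleZr. Qed.

Lemma qval_le f (a : R) : lemod f (a *: e) -> (qval f <= a%:E)%E.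
Proof. by move=> fa; apply: ge_ereal_inf; exists a%:E => //; exists a. Qed.

Lemma qval_ge f (a : R) : lemod (a *: e) f -> (a%:E <= qval f)%E.
Proof.
move=> af; apply/ereal_infP => _ [b /= fb <-]; rewrite lee_fin.
exact/lemod_scale_le/(lemod_trans af).
Qed.

Lemma lt_qval f (a : R) : (a%:E < qval f)%E -> lemod (a *: e) f.
Proof.
move=> af; have [//|/qval_le] := lemod_total (a *: e) f.
by rewrite leNgt af.
Qed.

Lemma qval_lt f (a : R) : (qval f < a%:E)%E -> lemod f (a *: e).
Proof.
move=> /ereal_inf_lt[_ [b /= fb <-]]; rewrite lte_fin => /ltW ba.
exact/(lemod_trans fb)/le_lemod_scale.
Qed.

Lemma qval_homo f g : lemod f g -> (qval f <= qval g)%E.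
Proof.
move=> fg; apply: le_from_below => c /lt_qval cf.
exact/qval_ge/(lemod_trans cf).
Qed.

Lemma qval_const (a : R) : qval (a *: e) = a%:E.
Proof. by apply/eqP; rewrite eq_le qval_le ?qval_ge//; exact: lemod_refl. Qed.

Lemma qval0 : qval 0 = 0%E.
Proof. by rewrite -(scale0r e) qval_const. Qed.

Lemma qvalN f : qval (- f) = (- qval f)%E.
Proof.
apply/eqP; rewrite eq_le; apply/andP; split.
  rewrite leeNr; apply: le_from_below => c cf; rewrite leeNr -EFinN.
  by apply: qval_le; rewrite scaleNr lemodN; exact: lt_qval.
apply: le_from_below => c; rewrite lteNr -EFinN => /qval_lt fc.
by apply: qval_ge; rewrite -lemodN opprK -scaleNr.
Qed.

(** Modulo [P] the elements [f] and [g] are comparable, and the larger one is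
    their join. *)
Lemma qval_join f g : qval (f `|` g)%O = maxe (qval f) (qval g).
Proof.
wlog fg : f g / lemod f g => [hw|].
  by have [/hw//|/hw] := lemod_total f g; rewrite joinC maxC.
rewrite max_r ?qval_homo//; apply/eqP; rewrite eq_le !qval_homo//.
  by apply: le_lemod; exact: leUr.
by apply: lemod_join => //; exact: lemod_refl.
Qed.

Lemma qval_meet f g : qval (f `&` g)%O = mine (qval f) (qval g).
Proof.
wlog fg : f g / lemod f g => [hw|].
  by have [/hw//|/hw] := lemod_total f g; rewrite meetC minC.
rewrite min_l ?qval_homo//; apply/eqP; rewrite eq_le !qval_homo//.
  by apply: lemod_meet => //; exact: lemod_refl.
by apply: le_lemod; exact: leIl.
Qed.

Lemma qvalZ_gt0 (a : R) f : 0 < a -> qval (a *: f) = (a%:E * qval f)%E.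
Proof.
move=> a0; have ai0 : 0 < a^-1 by rewrite invr_gt0.
have an0 := lt0r_neq0 a0.
apply/eqP; rewrite eq_le; apply/andP; split; apply: le_from_below => c.
  move=> /lt_qval /(lemodZ (ltW ai0)); rewrite scalerK// scalerA => /qval_ge.
  by rewrite EFinM lee_pdivrMl.
rewrite -lte_pdivrMl// -EFinM => /lt_qval /(lemodZ (ltW a0)).
by rewrite scalerA mulVKf// => /qval_ge.
Qed.

Lemma qvalZ (a : R) f : qval (a *: f) = (a%:E * qval f)%E.
Proof.
have [a0|a0|->] := ltgtP a 0; last by rewrite scale0r qval0 mul0e.
  rewrite -[a *: f]opprK -scaleNr qvalN qvalZ_gt0 ?oppr_gt0//.
  by rewrite EFinN mulNe oppeK.
exact: qvalZ_gt0.
Qed.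

(** Approximating both values from below gives superadditivity; the converse
    inequality is superadditivity for [- f] and [- g]. *)
Lemma qvalD f g : qval f \is a fin_num -> qval g \is a fin_num ->
  qval (f + g) = (qval f + qval g)%E.
Proof.
have sup h k : qval h \is a fin_num -> qval k \is a fin_num ->
    (qval h + qval k <= qval (h + k)%R)%E.
  move=> hf kf; rewrite -(fineK hf) -(fineK kf) -EFinD.
  set x := fine (qval h); set y := fine (qval k).
  apply: le_from_below => c; rewrite lte_fin => cxy.
  pose d := (x + y - c) / 2.
  have d0 : 0 < d by rewrite divr_gt0 // subr_gt0.
  have -> : c = (x - d) + (y - d).
    by rewrite addrACA -opprD -splitr opprB addrC subrK.
  apply: qval_ge; rewrite scalerDl; apply: lemodD; apply: lt_qval.
    by rewrite -(fineK hf) lte_fin ltrBlDr ltrDl.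
  by rewrite -(fineK kf) lte_fin ltrBlDr ltrDl.
move=> ff gf; apply/eqP; rewrite eq_le sup// andbT.
have Nfin h : qval h \is a fin_num -> qval (- h) \is a fin_num.
  by move=> hf; rewrite qvalN -(fineK hf) -EFinN.
have := sup _ _ (Nfin _ ff) (Nfin _ gf); rewrite !qvalN.
by rewrite -opprD qvalN -fin_num_oppeD// leeN2.
Qed.

End ValueAlong.

(** The scale matters only up to [P]; this makes the value independent of the
    chosen unit. *)
Lemma qval_unit_eq e e' : lemod e e' -> lemod e' e -> qval e = qval e'.
Proof.
move=> h h'; have imp d d' : lemod d d' -> lemod d' d ->
    forall f (a : R), lemod f (a *: d) -> lemod f (a *: d').
  move=> dd' d'd f a fa; apply: (lemod_trans fa).
  have [a0|/ltW a0] := leP 0 a; first exact: lemodZ.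
  rewrite -lemodN -!scaleNr; apply: lemodZ => //.
  by rewrite oppr_ge0.
apply/funext => f; rewrite /qval; congr (ereal_inf (_ @` _)).
by apply/seteqP; split=> a /=; exact: imp.
Qed.

End OrderModuloPrime.

(** * Truncations *)

Section TruncationTheory.
Context {R : realType} {L : vectorLatticeType R}.
Implicit Types (t : truncation L) (f g h u v w d : poscone L) (P : prime_ideal L).

Lemma trunc_fixed t g h : pval h <= pval (t g) -> pval (t h) = pval h.
Proof.
move=> hg; apply/eqP; rewrite eq_le trunc_le /=.
by apply: le_trans (trunc_meet_le t h g); rewrite lexI lexx.
Qed.

Lemma trunc_homo t f g : pval f <= pval g -> pval (t f) <= pval (t g).
Proof.
move=> fg; apply: le_trans (trunc_meet_le t g f); rewrite lexI lexx andbT.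
exact: le_trans (trunc_le t f) fg.
Qed.

Lemma unit_trunc_notin t P u : unit_at t P u -> ~ P (pval (t u)).
Proof.
move=> Pu Ptu; apply: Pu.
apply: (ideal_le (pideal_ideal P) Ptu (pval_ge0 _)).
by apply: trunc_homo; rewrite /= vle_subl_addr -[leLHS]addr0 vleD ?pval_ge0.
Qed.

(** Modulo [P], a unit [u] lies strictly above its truncation, so the bound
    [u /\ t w <= t u] can only come from [t w]. *)
Lemma lemod_trunc_unit t P u w :
  unit_at t P u -> lemod P (pval (t w)) (pval (t u)).
Proof.
move=> Pu; have wu := trunc_meet_le t u w.
have [h|h] := lemod_total P (pval (t w)) (pval u).
  exact: lemod_trans (lemod_meet h (lemod_refl _ _)) (le_lemod _ wu).
exfalso; apply: Pu.
apply: (@ideal_le _ _ P _ (pval (remainder t u)) (pideal_ideal P) _ (pval_ge0 _)).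
  have := lemod_trans (lemod_meet (lemod_refl _ _) h) (le_lemod _ wu).
  by rewrite /lemod vpos_id ?vsubr_ge0 ?trunc_le.
exact: trunc_le.
Qed.

Lemma lemod_trunc_meet t P u f :
  unit_at t P u -> lemod P (pval (t f)) (pval f `&` pval (t u))%O.
Proof.
move=> Pu; apply: lemod_meet; last exact: lemod_trunc_unit.
exact/le_lemod/trunc_le.
Qed.

(** If the truncated excess of [v] stays below some truncated element, then the
    excess itself is below the unit: it is not cut by the truncation. *)
Lemma lemod_small_excess t P u v w : unit_at t P u ->
  ~ P (vpos (pval (t w) - pval (t (remainder t v)))) ->
  lemod P (pval v) (2 *: pval (t u)).
Proof.
move=> Pu Pwv; have -> : pval v = pval (remainder t v) + pval (t v).
  by rewrite /= subrK.
rewrite -[2]/(1 + 1) scalerDl scale1r; apply: lemodD; last exact: lemod_trunc_unit.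
have [//|h] := lemod_total P (pval (remainder t v)) (pval (t u)).
exfalso; apply: Pwv; apply: lemod_trans (lemod_trunc_unit w Pu) _.
apply: lemod_trans (lemod_meet h (lemod_refl _ _)) _.
exact/le_lemod/trunc_meet_le.
Qed.

(** No nonzero [h] has all its multiples fixed by [t], so some multiple [v] of
    [h] has a nonzero excess. The excess is below a multiple of [h], hence not
    disjoint from [h]; and since [h = t h], its meet with [h] is below its
    truncation, so a prime missing that meet has [v] as a unit. *)
Lemma exists_unit t h : pval (t h) = pval h -> pval h <> 0 ->
  exists n, let v := pmuln h n in
  [/\ (0 < n)%N, (pval (remainder t v) `&` pval h)%O <> 0
    & forall P, ~ P (pval (remainder t v) `&` pval h)%O -> unit_at t P v].
Proof.
move=> th h0.
have [n n0 tn] : exists2 n, (0 < n)%N & t (pmuln h n) <> pmuln h n.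
  apply: contrapT => hn; apply: h0; apply: (@trunc_arch _ _ t) => n n0.
  by apply: contrapT => tn; apply: hn; exists n.
exists n; split=> // [rh0|P Pr Prem].
  have [|P] := @exists_prime _ _ (pval (remainder t (pmuln h n))) (pval_ge0 _).
    by move=> /subr0_eq e; apply: tn; exact/val_inj.
  have [P0 _ iZ _] := pideal_ideal P.
  have [//|Ph] := @pideal_prime _ _ P _ _ (eq_ind_r P P0 rh0).
  apply; apply: (ideal_le (pideal_ideal P) _ (pval_ge0 _)).
    exact: (iZ n%:R _ Ph).
  by rewrite scaler_nat /= vle_subl_addr -[leLHS]addr0 vleD ?pval_ge0.
apply: Pr; apply: (ideal_le (pideal_ideal P) Prem).
  exact: vmeet_ge0 (pval_ge0 _) (pval_ge0 _).
by rewrite -th; exact: trunc_meet_le.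
Qed.

Lemma archimedean_exceeds f h : archimedean L -> pval h <> 0 ->
  exists2 n, (0 < n)%N & vpos (pval h *+ n - pval f) <> 0.
Proof.
move=> arch h0; apply: contrapT => hn; apply: h0.
apply: (arch _ _ (pval_ge0 h) (pval_ge0 f)) => n n0; apply: contrapT => hnf.
apply: hn; exists n => //; apply: vpos_neq0.
by rewrite vle_subl_addr add0r.
Qed.

Section TruncationByElement.
Variable d : poscone L.

Definition meet_with f : poscone L := PosCone (vmeet_ge0 (pval_ge0 f) (pval_ge0 d)).

Lemma meet_with_nonzero : pval d <> 0 -> exists f, pval (meet_with f) <> 0.
Proof. by exists d; rewrite /= meetxx. Qed.

Lemma meet_with_meet_le f g :
  (pval f `&` pval (meet_with g))%O <= pval (meet_with f).
Proof. by rewrite /= lexI leIl (le_trans (leIr _ _)) ?leIr. Qed.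

Lemma meet_with_le f : pval (meet_with f) <= pval f.
Proof. exact: leIl. Qed.

Lemma meet_with_arch f : archimedean L ->
  (forall n, (0 < n)%N -> meet_with (pmuln f n) = pmuln f n) -> pval f = 0.
Proof.
move=> arch h; apply: (arch _ _ (pval_ge0 f) (pval_ge0 d)) => n n0.
by have /(congr1 (@pval _ _)) /= <- := h _ n0; exact: leIr.
Qed.

End TruncationByElement.

(** Otherwise meeting with [d], a truncation because [L] is Archimedean, is
    disjoint from all members of [T] and could be added to [T]. *)
Lemma maximal_meets (T : set (truncation L)) d :
  archimedean L -> maximal_multi_truncation T -> pval d <> 0 ->
  exists t w, T t /\ (pval d `&` pval (t w))%O <> 0.
Proof.
move=> arch [Tm Tmax] d0; apply: contrapT => hd.
have disj t w : T t -> (pval d `&` pval (t w))%O = 0.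
  by move=> Tt; apply: contrapT => h; apply: hd; exists t, w.
pose s := Truncation (meet_with_nonzero d0) (@meet_with_meet_le d)
  (meet_with_le d) (fun f => meet_with_arch arch).
have sdisj t f : T t -> (pval (t f) `&` pval (s f))%O = 0.
  move=> Tt; apply/eqP; rewrite eq_le; apply/andP; split.
    by rewrite -(disj t f Tt) lexI leIl andbT (le_trans (leIr _ _)) ?leIr.
  exact: vmeet_ge0 (pval_ge0 _) (pval_ge0 _).
apply: (Tmax (T `|` [set s])).
  move=> t1 t2 [T1|->] [T2|->] t12 f; [exact: Tm|exact: sdisj| |by []].
  by rewrite meetC sdisj.
split; first by left.
move=> /(_ s (or_intror erefl)) Ts; apply: (d0).
by have := disj s d Ts; rewrite /= !meetxx.
Qed.

End TruncationTheory.

(** * Extended real functions and the hull-kernel topology *)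

(** The open rays with finite endpoint form a subbase of the topology. *)
Lemma continuous_ereal {R : realType} {X : topologicalType} (f : X -> \bar R) :
  (forall x (a : R), (f x < a%:E)%E -> \forall y \near x, (f y < a%:E)%E) ->
  (forall x (a : R), (a%:E < f x)%E -> \forall y \near x, (a%:E < f y)%E) ->
  continuous f.
Proof.
move=> fu fl x A; rewrite /nbhs /= /ereal_nbhs /nbhs /=.
case E : (f x) => [r| |] /=.
- move=> [e /= e0 eA].
  have h1 : \forall y \near x, (f y < (r + e)%:E)%E.
    by apply: fu; rewrite E lte_fin ltrDl.
  have h2 : \forall y \near x, ((r - e)%:E < f y)%E.
    by apply: fl; rewrite E lte_fin ltrBlDr ltrDl.
  apply: filterS2 h1 h2 => y; rewrite /preimage /=.
  case: (f y) => [s| |] //; rewrite !lte_fin => h1 h2; apply: eA => /=.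
  by rewrite distrC ltr_distl h1 h2.
- move=> [M [_ MA]]; have : \forall y \near x, (M%:E < f y)%E.
    by apply: fl; rewrite E ltry.
  by apply: filterS => y; exact: MA.
- move=> [M [_ MA]]; have : \forall y \near x, (f y < M%:E)%E.
    by apply: fu; rewrite E ltNyr.
  by apply: filterS => y; exact: MA.
Qed.

Section HullKernel.
Context {R : realType} {L : vectorLatticeType R}.
Implicit Types (P : prime_ideal L) (g : L).

Lemma open_cohull (g : poscone L) : open (cohull setT (pval g)).
Proof.
exists [set g] => //; apply/seteqP; split=> [P [_ ->]//|P Pg].
by exists g.
Qed.

Lemma nbhs_cohull P (A : set (prime_ideal L)) : nbhs P A ->
  exists2 g : poscone L, ~ P (pval g) & forall P', ~ P' (pval g) -> A P'.
Proof.
rewrite nbhsE => -[U [[D _ <-] [g Dg [_ Pg]]] UA]; exists g => // P' Pg'.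
by apply: UA; exists g.
Qed.

Lemma dense_notin (Q : set (prime_ideal L)) g : dense Q -> 0 <= g -> g <> 0 ->
  exists2 P, Q P & ~ P g.
Proof.
move=> dQ g0 gn0; have [P Pg] := exists_prime g0 gn0.
have [|P' [[_ Pg'] QP']] := dQ _ _ (open_cohull (PosCone g0)).
  by exists P; split.
by exists P'.
Qed.

End HullKernel.

(** * The representation by extended real functions *)

Section Representation.
Context {R : realType} {L : vectorLatticeType R}.
Variables (T : set (truncation L)) (Q : set (prime_ideal L)).
Implicit Types (P : Qdom Q T) (f g : L) (t : truncation L).

Lemma near_notin P g : 0 <= g -> ~ val P g -> \forall P' \near P, ~ val (P' : Qdom Q T) g.
Proof.
move=> g0 Pg; have cv : continuous (set_val : Qdom Q T -> prime_ideal L).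
  exact: initial_continuous.
have hP : nbhs (set_val P) (cohull setT g).
  apply: open_nbhs_nbhs; split; first exact: (open_cohull (PosCone g0)).
  by split; rewrite // set_valE.
have : nbhs P (set_val @^-1` cohull setT g) := cv P _ hP.
by apply: filterS => P' [_]; rewrite set_valE.
Qed.

Lemma nbhs_notin P (A : set (Qdom Q T)) : nbhs P A ->
  exists2 g : poscone L, ~ val P (pval g) &
    forall P', ~ val P' (pval g) -> A P'.
Proof.
rewrite nbhsE => -[_ [[U oU <-] UP] UA].
have [g Pg gU] := nbhs_cohull (open_nbhs_nbhs (conj oU UP)).
exists g; first by rewrite -set_valE.
by move=> P' Pg'; apply: UA; apply: gU; rewrite set_valE.
Qed.

Lemma Qdom_Q P : Q (val P).
Proof. by have [t _ [f _ []]] := set_valP P. Qed.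

Lemma exists_Qdom t (w : poscone L) p : T t -> Q p -> ~ p (pval (t w)) ->
  exists P, val P = p.
Proof.
move=> Tt Qp pw; have h : Qdom Q T p by exists t => //; exists w.
by exists (exist _ p (mem_set h)).
Qed.

Lemma trunc_atP P : T (trunc_at P) /\ Qstar Q (trunc_at P) (val P).
Proof. by rewrite /trunc_at; case: cid2. Qed.

Lemma hat_cases P : (forall f, hat f P = 0%E) \/
  exists e, [/\ 0 <= e, ~ val P e & forall f, hat f P = qval (val P) e f].
Proof.
have [une|une] := pselect (unit_at (trunc_at P) (val P) !=set0); last first.
  by left=> f; rewrite /hat; case: asboolP.
right; exists (pval (trunc_at P (choose_unit (trunc_at P) (val P)))); split.
- exact: pval_ge0.
- by apply: unit_trunc_notin; exact: xgetPex.
- by move=> f; rewrite /hat; case: asboolP.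
Qed.

Lemma hat0 P : hat 0 P = 0%E.
Proof. by have [->//|[e [e0 Pe ->]]] := hat_cases P; exact: qval0. Qed.

Lemma hat_homo P f g : f <= g -> (hat f P <= hat g P)%E.
Proof.
move=> fg; have [h|[e [e0 Pe h]]] := hat_cases P; rewrite !h//.
by apply: qval_homo => //; exact: le_lemod.
Qed.

Lemma hatN P f : hat (- f) P = (- hat f P)%E.
Proof.
have [h|[e [e0 Pe h]]] := hat_cases P; rewrite !h ?oppe0//.
exact: qvalN.
Qed.

Lemma hatD P f g : hat f P \is a fin_num -> hat g P \is a fin_num ->
  hat (f + g) P = (hat f P + hat g P)%E.
Proof.
have [h|[e [e0 Pe h]]] := hat_cases P; rewrite !h ?adde0//.
exact: qvalD.
Qed.

Lemma hatZ P (a : R) f : hat (a *: f) P = (a%:E * hat f P)%E.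
Proof.
have [h|[e [e0 Pe h]]] := hat_cases P; rewrite !h ?mule0//.
exact: qvalZ.
Qed.

Lemma hat_join P f g : hat (f `|` g)%O P = maxe (hat f P) (hat g P).
Proof.
have [h|[e [e0 Pe h]]] := hat_cases P; rewrite !h ?maxxx//.
exact: qval_join.
Qed.

Lemma hat_meet P f g : hat (f `&` g)%O P = mine (hat f P) (hat g P).
Proof.
have [h|[e [e0 Pe h]]] := hat_cases P; rewrite !h ?minxx//.
exact: qval_meet.
Qed.

Hypothesis multiT : multi_truncation T.

(** Truncations are monotone, so if [s f] and [t g] are both outside [p], then so
    are [s h] and [t h] with [h] the join of [f] and [g]; but these two are
    disjoint. *)
Lemma Qstar_inj s t p : T s -> T t -> Qstar Q s p -> Qstar Q t p -> s = t.
Proof.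
move=> Ts Tt [f _ [_ pf]] [g _ [_ pg]]; apply: contrapT => st.
have fg0 : 0 <= (pval f `|` pval g)%O by rewrite lexU2 // pval_ge0.
have iP := pideal_ideal p; pose h := PosCone fg0.
have : p (pval (s h) `&` pval (t h))%O by rewrite multiT//; case: iP.
move=> /pideal_prime[] ph; [apply: pf|apply: pg].
  apply: (ideal_le iP ph (pval_ge0 _)); apply: trunc_homo; exact: leUl.
apply: (ideal_le iP ph (pval_ge0 _)); apply: trunc_homo; exact: leUr.
Qed.

Lemma trunc_at_eq t P : T t -> Qstar Q t (val P) -> trunc_at P = t.
Proof.
by move=> Tt; have [Ts Qs] := trunc_atP P; exact: Qstar_inj Qs.
Qed.

Lemma Qstar_notin t P (w : poscone L) : ~ val P (pval (t w)) -> Qstar Q t (val P).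
Proof. by exists w => //; split=> //; exact: Qdom_Q. Qed.

Lemma hat_unit t P u : T t -> unit_at t (val P) u ->
  forall f, hat f P = qval (val P) (pval (t u)) f.
Proof.
move=> Tt Pu f; rewrite /hat (trunc_at_eq Tt); last exact: Qstar_notin Pu.
case: asboolP => [|[]]; last by exists u.
move=> /(@xgetPex _ point) Pc; rewrite -/(qval _ _ _).
by rewrite (qval_unit_eq (lemod_trunc_unit _ Pu) (lemod_trunc_unit _ Pc)).
Qed.

Lemma hat_no_unit t P : T t -> Qstar Q t (val P) ->
  (forall u, ~ unit_at t (val P) u) -> forall f, hat f P = 0%E.
Proof.
move=> Tt QP nu f; rewrite /hat (trunc_at_eq Tt QP).
by case: asboolP => [[u /nu]|].
Qed.

Lemma unit_cases t P : T t -> Qstar Q t (val P) ->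
  (forall f, hat f P = 0%E) \/
  exists2 u, unit_at t (val P) u &
    forall f, hat f P = qval (val P) (pval (t u)) f.
Proof.
move=> Tt QP; have [[u Pu]|nu] := pselect (exists u, unit_at t (val P) u).
  by right; exists u => //; exact: hat_unit.
left; apply: (hat_no_unit Tt QP) => u Pu; apply: nu; by exists u.
Qed.

(** If [P] has a unit [u], then [u] remains a unit nearby, and a strict inequality
    against a multiple of [t u] also persists.

    If [P] has no unit, the value at [P] is 0 and the truncated excess of every
    [v] lies in [P]. Take [v] a large multiple [k] of [f^+] and some [t w]
    outside [P]. That [t w] exceeds the truncated excess of [v] is then true at
    [P], hence nearby, where it bounds [v] by twice the unit at each point that
    has one. *)
Lemma hat_near_lt f P (a : R) : (hat f P < a%:E)%E ->
  \forall P' \near P, (hat f P' < a%:E)%E.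
Proof.
have [Tt QP] := trunc_atP P; set t := trunc_at P in Tt QP *.
have [[u Pu]|nu] := pselect (exists u, unit_at t (val P) u); last first.
  have nuP u : ~ unit_at t (val P) u by move=> Pu; apply: nu; exists u.
  rewrite (hat_no_unit Tt QP nuP) lte_fin => a0.
  have [w _ [_ Pw]] := QP.
  (* [2 / k < a], so that a bound of 2 on [k *: f^+] gives one below [a] on [f] *)
  pose k := 4 / a; have k0 : 0 < k by rewrite divr_gt0.
  pose v := PosCone (vlat_scale_ge0 _ _ (ltW k0) (vpos_ge0 f)).
  have Pg : val P (pval (t (remainder t v))) by apply: contrapT; exact: nuP.
  have Pwg : ~ val P (vpos (pval (t w) - pval (t (remainder t v)))).
    move=> h; apply: Pw; apply/(lemod0P _ (pval_ge0 _)).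
    by apply: (lemod_trans h); exact/(lemod0P _ (pval_ge0 _)).
  apply: filterS2 (near_notin (pval_ge0 _) Pw) (near_notin (vpos_ge0 _) Pwg).
  move=> P' Pw' Pwg'; have [->|[u Pu ->]] := unit_cases Tt (Qstar_notin Pw').
    by rewrite lte_fin.
  have k2a : k^-1 * 2 < a.
    by rewrite invf_div mulrAC ltr_pdivrMr// ltr_pM2l// ltr_nat.
  apply: (@le_lt_trans _ _ (k^-1 * 2)%:E); last by rewrite lte_fin.
  apply: qval_le; apply: lemod_trans (le_lemod _ (le_vpos f)) _.
  have ki0 : 0 <= k^-1 by rewrite invr_ge0 ltW.
  have := lemodZ ki0 (lemod_small_excess Pu Pwg').
  by rewrite /= scalerK ?lt0r_neq0// scalerA.
have hu := hat_unit Tt Pu.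
rewrite hu => /ereal_between[b fb ba].
have [c /(qval_lt (pval_ge0 _)) fc cb] := ereal_between fb.
have Pbc : ~ val P (vpos (b *: pval (t u) - f)).
  move=> Pb; have := lemod_trans Pb fc.
  move=> /(lemod_scale_le (pval_ge0 _) (unit_trunc_notin Pu)).
  by rewrite leNgt -lte_fin cb.
apply: filterS2 (near_notin (pval_ge0 _) Pu) (near_notin (vpos_ge0 _) Pbc).
move=> P' Pu' Pb'; rewrite (hat_unit Tt Pu'); apply: le_lt_trans ba.
exact/qval_le/lemod_vpos.
Qed.

Lemma hat_near_gt f P (a : R) : (a%:E < hat f P)%E ->
  \forall P' \near P, (a%:E < hat f P')%E.
Proof.
rewrite -[f]opprK hatN lteNr -EFinN => /hat_near_lt.
by apply: filterS => P'; rewrite (hatN _ (- f)) lteNr EFinN.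
Qed.

Lemma hat_continuous f : continuous (hat f : Qdom Q T -> \bar R).
Proof. by apply: continuous_ereal; [exact: hat_near_lt|exact: hat_near_gt]. Qed.

Lemma near_Qstar t P : Qstar Q t (val P) ->
  \forall P' \near P, Qstar Q t (val (P' : Qdom Q T)).
Proof.
move=> [w _ [_ Pw]]; apply: filterS (near_notin (pval_ge0 _) Pw) => P' Pw'.
exact: Qstar_notin Pw'.
Qed.

(** The sets [Qstar Q t] with [t] in [T] are open, pairwise disjoint and cover the
    domain, so each of them is closed in it as well. *)
Lemma near_indic t P : T t -> \forall P' \near P,
  (\1_(Qstar Q t) (val (P' : Qdom Q T)) : R) = \1_(Qstar Q t) (val P).
Proof.
move=> Tt; have [Ts QP] := trunc_atP P.
apply: filterS (near_Qstar QP) => P' QP'; rewrite !indicE; congr (_ : bool)%:R.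
apply/idP/idP; rewrite !inE => QPt.
  by rewrite -(Qstar_inj Ts Tt QP' QPt).
by rewrite -(Qstar_inj Ts Tt QP QPt).
Qed.

Lemma indic_continuous t : T t ->
  continuous (fun P : Qdom Q T => (\1_(Qstar Q t) (val P) : R)%:E).
Proof.
move=> Tt; apply: continuous_ereal => P a Pa.
  by apply: filterS (near_indic P Tt) => P' ->.
by apply: filterS (near_indic P Tt) => P' ->.
Qed.

Definition indic_Cinf t (Tt : T t) : Cinf R (Qdom Q T).
Proof.
apply: (MkCinf (indic_continuous Tt)) => O [P OP] oO.
by exists P.
Defined.

(** At a prime with a unit [u] the truncation of [f] agrees with the meet of [f]
    and [t u], and [t u] has value 1. Outside [Qstar Q t] the prime contains
    every value of [t]. *)
Lemma hat_trunc t (f : poscone L) P : T t ->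
  hat (pval (t f)) P = mine (\1_(Qstar Q t) (val P))%:E (hat (pval f) P).
Proof.
move=> Tt; rewrite indicE; have [QP|QP] := pselect (Qstar Q t (val P)).
  rewrite mem_set//; have [h|[u Pu h]] := unit_cases Tt QP.
    by rewrite !h min_r// lee_fin.
  have Ptu := unit_trunc_notin Pu; have tu0 := pval_ge0 (t u).
  have e1 : qval (val P) (pval (t u)) (pval (t u)) = 1%E.
    by rewrite -[X in qval _ _ X]scale1r qval_const.
  rewrite !h minC -[1%E]e1 -qval_meet//; apply/eqP; rewrite eq_le !qval_homo//.
    by apply: le_lemod; exact: trunc_meet_le.
  exact: lemod_trunc_meet.
rewrite memNset//= min_l; last by have := hat_homo P (pval_ge0 f); rewrite hat0.
have Ptf : val P (pval (t f)) by apply: contrapT => /Qstar_notin.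
have [->//|[e [e0 Pe ->]]] := hat_cases P.
transitivity (qval (val P) e 0); last exact: qval0.
apply/eqP; rewrite eq_le !qval_homo//.
  by apply: le_lemod; exact: pval_ge0.
by apply/lemod0P => //; exact: pval_ge0.
Qed.

Hypotheses (arch : archimedean L) (denseQ : dense Q).

Lemma hat_vabs_finite P f (a : R) :
  (hat (vabs f) P <= a%:E)%E -> `|hat f P|%E != +oo%E.
Proof.
move=> fa; have h g : g <= vabs f -> (hat g P <= a%:E)%E.
  by move=> gf; apply: le_trans fa; exact: hat_homo.
have := h _ (leN_vabs f); have := h _ (le_vabs f); rewrite hatN.
by case: (hat f P).
Qed.

(** Around [P] pick [h = t h] outside [P], as small as wanted. By the Archimedean
    property some [m] times [h] is not below [|f|]. On the nonempty basic open
    set where the excess of [m] times [h] over [|f|] is outside the prime, [|f|]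
    is below [m] times [h], and [h = t h] has value at most 1. *)
Lemma hat_finite_dense f : dense [set P : Qdom Q T | `|hat f P|%E != +oo%E].
Proof.
move=> O [P OP] oO.
have [g Pg gO] := nbhs_notin (open_nbhs_nbhs (conj oO OP)).
have [Tt [w _ [_ Pw]]] := trunc_atP P; set t := trunc_at P in Tt Pw *.
pose h := PosCone (vmeet_ge0 (pval_ge0 g) (pval_ge0 (t w))).
have th : pval (t h) = pval h by apply: (@trunc_fixed _ _ _ w); exact: leIr.
have h0 : pval h <> 0.
  move=> h0; have [/= P0 _ _ _] := pideal_ideal (val P).
  by have /pideal_prime[] : val P (pval h) by rewrite h0.
have [m m0 rn0] := archimedean_exceeds (PosCone (vabs_ge0 f)) arch h0.
have [p Qp pr] := dense_notin denseQ (vpos_ge0 _) rn0.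
have ph : ~ p (pval h).
  have [_ _ iZ _] := pideal_ideal p => ph; apply: pr.
  apply: (ideal_le (pideal_ideal p) (iZ m%:R _ ph) (vpos_ge0 _)).
  rewrite scaler_nat; apply: vpos_le; last exact: vlat_mulrn_ge0 (pval_ge0 h).
  by rewrite vle_subl_addr -[leLHS]addr0 vleD ?vabs_ge0.
have [P' P'p] : exists P', val P' = p.
  by apply: (exists_Qdom (w := h) Tt Qp); rewrite th.
rewrite -P'p in pr ph *; exists P'; split.
  apply: gO => /(ideal_le (pideal_ideal (val P'))) Pg'; apply: ph.
  by apply: Pg'; [exact: pval_ge0|exact: leIl].
apply: (@hat_vabs_finite _ _ m%:R).
have Ph : ~ val P' (pval (t h)) by rewrite th.
have [->|[u Pu ->]] := unit_cases Tt (Qstar_notin Ph); first by rewrite lee_fin.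
apply: qval_le; apply: lemod_trans (lemod_vpos pr) _.
by rewrite -scaler_nat -th; apply: lemodZ => //; exact: lemod_trunc_unit.
Qed.

Hypothesis maxT : maximal_multi_truncation T.

(** Maximality yields [h = t h] with [0 < h <= d], and the multiple of [h] by some [n] is
    a unit on a nonempty basic open set; there [d] has value at least [1 / n].
    An open set, rather than a point, is needed: additivity holds only where the
    summands are finite, and injectivity looks for such a point in this set. *)
Lemma hat_positive (d : poscone L) : pval d <> 0 ->
  exists r : L, [/\ 0 <= r, exists P : Qdom Q T, ~ val P r &
    forall P : Qdom Q T, ~ val P r -> (0 < hat (pval d) P)%E].
Proof.
move=> d0; have [t [w [Tt dw0]]] := maximal_meets arch maxT d0.
pose h := PosCone (vmeet_ge0 (pval_ge0 d) (pval_ge0 (t w))).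
have th : pval (t h) = pval h by apply: (@trunc_fixed _ _ _ w); exact: leIr.
have [n [n0 rn0 unitP]] := exists_unit th dw0.
set v := pmuln h n in rn0 unitP.
set r := (_ `&` _)%O in rn0 unitP.
have r0 : 0 <= r := vmeet_ge0 (pval_ge0 _) (pval_ge0 _).
exists r; split=> // [|P Pr].
  have [p Qp pr] := dense_notin denseQ r0 rn0.
  have [|P Pp] := exists_Qdom (w := h) Tt Qp; last by exists P; rewrite Pp.
  rewrite th => ph; apply: pr; apply: (ideal_le (pideal_ideal p) ph r0).
  exact: leIr.
have Pv := unitP _ Pr; rewrite (hat_unit Tt Pv).
have ni0 : 0 < n%:R^-1 :> R by rewrite invr_gt0 ltr0n.
apply: (@lt_le_trans _ _ (n%:R^-1)%:E); first by rewrite lte_fin.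
apply: qval_ge; [exact: pval_ge0|exact: unit_trunc_notin|].
apply: le_lemod; apply: (@le_trans _ _ (pval h)); last exact: leIl.
apply: (@le_trans _ _ (n%:R^-1 *: pval v)).
  by rewrite vleZ ?(ltW ni0)// trunc_le.
have -> : pval v = n%:R *: pval h by rewrite scaler_nat.
by rewrite scalerK// pnatr_eq0 -lt0n.
Qed.

Definition hat_Cinf f : Cinf R (Qdom Q T) :=
  MkCinf (@hat_continuous f) (@hat_finite_dense f).

(** If the images agree, then at a point where they are finite the value of
    [|f - g|] is 0. Such points are dense, so [|f - g|] cannot be nonzero. *)
Lemma hat_Cinf_inj : injective hat_Cinf.
Proof.
move=> f g fg; apply: contrapT => fgn.
have d0 : vabs (f - g) <> 0.
  move=> d0; apply: fgn; apply/eqP; rewrite eq_le; apply/andP; split.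
    by rewrite -[leRHS]add0r -vle_subl_addr -d0 le_vabs.
  by rewrite -[leRHS]add0r -vle_subl_addr -d0 -opprB leN_vabs.
have [r [r0 [P Pr] rpos]] := hat_positive (d := PosCone (vabs_ge0 _)) d0.
have [P' [Pr' [ff gf]]] : ([set P : Qdom Q T | ~ val P r]%classic `&`
    ([set x | `|hat_Cinf f x|%E != +oo%E] `&`
     [set x | `|hat_Cinf g x|%E != +oo%E])%classic) !=set0.
  apply: cinf_dense2; first by exists P.
  rewrite openE => P' Pr'; exact: near_notin.
have fing k : (`|hat_Cinf k P'|%E != +oo%E) -> hat k P' \is a fin_num.
  by rewrite /=; case: (hat k P').
have fgP : hat f P' = hat g P' by have := congr1 (fun c => cinf_fun c P') fg.
have := rpos _ Pr'; rewrite hat_join hatN.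
have gfin := fing _ gf.
have Ngfin : hat (- g) P' \is a fin_num by rewrite hatN fin_numN.
rewrite (hatD (fing _ ff) Ngfin) hatN fgP subee//.
by rewrite oppe0 maxxx ltxx.
Qed.

Lemma hat_Cinf_hom : cinf_lattice_hom hat_Cinf.
Proof.
split.
- by move=> f g P; exact: hatD.
- by move=> a f P; exact: hatZ.
- by move=> f g; apply: cinf_eq => P; exact: hat_join.
- by move=> f g; apply: cinf_eq => P; exact: hat_meet.
Qed.

End Representation.

Theorem theorem5p1 (R : realType) (L : vectorLatticeType R)
    (T : set (truncation L)) (Q : set (prime_ideal L)) :
  archimedean L -> maximal_multi_truncation T -> dense Q ->
  exists Lam : L -> Cinf R (Qdom Q T),
    [/\ forall (f : L) (P : Qdom Q T), Lam f P = hat f P,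
        injective Lam,
        cinf_lattice_hom Lam
      & forall t : truncation L, T t ->
          exists2 e : Cinf R (Qdom Q T),
            forall P : Qdom Q T, e P = (\1_(Qstar Q t) (val P))%:E
            & forall f : poscone L, Lam (t f) = (e `&` Lam f)%O].
Proof.
move=> arch maxT denseQ; have multiT := maxT.1.
exists (hat_Cinf multiT arch denseQ); split=> //.
- exact: hat_Cinf_inj.
- exact: hat_Cinf_hom.
move=> t Tt; exists (indic_Cinf Q multiT Tt) => // f.
by apply: cinf_eq => P; exact: hat_trunc.
Qed.
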